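(* The decision problem D-FSTOP is NP-hard, and hence the problem FSTOP of finding a feasible solution for an STOP instance is NP-hard.
   Context: STOP instance: a tuple $\langle G,S,P,s,t,p,d,M,T\rangle$ where $G=(N,A)$ is a finite (not necessarily complete) digraph; $s,t\in N$, $s\neq t$, are the origin and destination; $S,P\subseteq N\setminus\{s,t\}$ are the sets of mandatory and profitable vertices, with $N=S\cup P\cup\{s,t\}$ and $S\cap P=\emptyset$; $p_i\in\mathbb{Z}^+$ is a reward for each $i\in P$; $d_{ij}>0$ is a traverse time for each arc $(i,j)\in A$; $M$ is a finite set of identical vehicles, $m=|M|$; $T$ is a time limit. For encoding purposes, numerical data are rational numbers in binary. A feasible solution of the instance is a collection of at most $m$ routes; each route is a directed path in $G$ from $s$ to $t$ (visiting no vertex more than once) whose total traverse time is at most $T$; every vertex of $S$ belongs to exactly one route and every vertex of $P$ belongs to at most one route. D-FSTOP. Input: an STOP instance. Question: does it have a feasible solution? FSTOP. Input: an STOP instance. Output: a feasible solution of the instance, if any exists (otherwise, report that none exists). A decision problem is NP-hard if every problem in NP is polynomial-time many-one reducible to it; the search problem FSTOP is NP-hard in the sense that every problem in NP is polynomial-time Turing reducible to it. The Hamiltonian Path Problem on digraphs with prescribed end vertices (given a digraph and vertices $s,t$, is there a directed path from $s$ to $t$ visiting every vertex exactly once?) is known to be NP-complete. *)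

(* Defs.v *)
From HB Require Import structures.
From mathcomp Require Import all_boot all_order all_algebra.

Set Implicit Arguments.
Unset Strict Implicit.
Unset Printing Implicit Defensive.

Import Order.TTheory GRing.Theory Num.Theory.

Definition word := seq bool.
Definition language := word -> Prop.

(* Tape symbols are 0, 1 and the blank [None].  A tape is infinite in both
   directions: [tleft] lists the cells left of the head, nearest first, and
   [tright] the scanned cell followed by the cells right of it; all cells not
   listed are blank. *)
Definition symbol := option bool.

Record tape := Tape { tleft : seq symbol; tright : seq symbol }.

Variant move := MoveLeft | MoveRight | Stay.

Definition scanned (t : tape) : symbol := head None (tright t).

Definition write_move (a : symbol * move) (t : tape) : tape :=
  let r := a.1 :: behead (tright t) in
  match a.2 with
  | Stay => Tape (tleft t) r
  | MoveRight => Tape (a.1 :: tleft t) (behead r)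
  | MoveLeft => Tape (behead (tleft t)) (head None (tleft t) :: r)
  end.

Definition blank_tape : tape := Tape [::] [::].

Definition tape_of (w : word) : tape := Tape [::] (map Some w).

Fixpoint until_blank (r : seq symbol) : word :=
  if r is Some b :: r' then b :: until_blank r' else [::].

(* The word held by a tape starts at the head and ends before the first
   blank. *)
Definition word_on (t : tape) : word := until_blank (tright t).

(* [query q = Some q'] makes [q] a query state: in one step the word on
   [qry_tape] is submitted to the oracle, the whole content of [ans_tape] is
   replaced by the answer, and the machine enters state [q'].  As these tapes
   are distinct, every query has been written out by the machine. *)
Record machine := Machine {
  state : finType;
  tapes : finType;
  in_tape : tapes;
  out_tape : tapes;
  qry_tape : tapes;
  ans_tape : tapes;
  qry_neq_ans : qry_tape != ans_tape;
  start : state;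
  halting : pred state;
  query : state -> option state;
  delta : state -> {ffun tapes -> symbol} ->
          state * {ffun tapes -> symbol * move}
}.

Record config (M : machine) :=
  Config { cstate : state M; ctapes : {ffun tapes M -> tape} }.

Definition init (M : machine) (w : word) : config M :=
  Config (start M)
    [ffun i => if i == in_tape M then tape_of w else blank_tape].

Definition step (M : machine) (O : word -> word) (c : config M) : config M :=
  let: Config q ts := c in
  if halting q then c
  else if query q is Some q' then
    Config q' [ffun i => if i == ans_tape M
                         then tape_of (O (word_on (ts (qry_tape M))))
                         else ts i]
  else
    let: (q', a) := delta q [ffun i => scanned (ts i)] in
    Config q' [ffun i => write_move (a i) (ts i)].

Definition computes_within (M : machine) (O : word -> word)
    (x y : word) (n : nat) : Prop :=
  let c := iter n (step O) (init M x) in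
  halting (cstate c) /\ word_on (ctapes c (out_tape M)) = y.

Definition oracle_free (M : machine) : Prop :=
  forall q : state M, query q = None.

(* [fun n => c * n ^ k + c] ranges over a cofinal family of polynomials. *)
Definition poly_bound (c k : nat) (x : word) : nat := c * size x ^ k + c.

(* The oracle [id] is a dummy: the machine never queries it. *)
Definition poly_time (f : word -> word) : Prop :=
  exists M : machine, oracle_free M /\
  exists c k : nat, forall x : word,
    computes_within M id x (f x) (poly_bound c k x).

Definition pair_word (x y : word) : word :=
  flatten [seq [:: b; b] | b <- x] ++ [:: false; true] ++ y.

(* Polynomial-time verifiers with polynomially long certificates. *)
Definition NP (L : language) : Prop :=
  exists (V : word -> bool) (c k : nat),
    poly_time (fun w => [:: V w]) /\
    forall x : word,
      L x <-> exists y : word, size y <= poly_bound c k x /\ V (pair_word x y).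

Definition many_one_reducible (L L' : language) : Prop :=
  exists f : word -> word, poly_time f /\ forall x : word, L x <-> L' (f x).

Definition NP_hard (L' : language) : Prop :=
  forall L : language, NP L -> many_one_reducible L L'.

(* A search problem is a relation between instances and solutions (a string
   relation in the sense of Garey and Johnson).  A solver has to return some
   solution, tagged by [true], if there is one, and to report [false] if there
   is none. *)
Definition search_problem := word -> word -> Prop.

Definition solves (O : word -> word) (R : search_problem) : Prop :=
  forall w : word,
    (exists y : word, O w = true :: y /\ R w y) \/
    (O w = [:: false] /\ forall y : word, ~ R w y).

(* A single machine and a single time bound must work for every solver of [R]
   used as oracle. *)
Definition turing_reducible (L : language) (R : search_problem) : Prop :=
  exists (M : machine) (c k : nat),
  forall O : word -> word, solves O R ->
  forall x : word, exists b : bool,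
    computes_within M O x [:: b] (poly_bound c k x) /\ (b <-> L x).

Definition NP_hard_search (R : search_problem) : Prop :=
  forall L : language, NP L -> turing_reducible L R.

Definition enc_seq (X : Type) (e : X -> word) (s : seq X) : word :=
  flatten [seq true :: e x | x <- s] ++ [:: false].

Fixpoint bits_rec (fuel n : nat) : word :=
  if fuel is fuel'.+1 then
    if n == 0 then [::] else odd n :: bits_rec fuel' n./2
  else [::].

(* Binary digits, least significant first, without leading zeros. *)
Definition bits (n : nat) : word := bits_rec n n.

Definition enc_nat (n : nat) : word := enc_seq (fun b => [:: b]) (bits n).

Definition enc_unary (n : nat) : word := nseq n true ++ [:: false].

Definition enc_rat (q : rat) : word :=
  (q < 0)%R :: enc_nat `|numq q| ++ enc_nat `|denq q|.

Record hpp_instance := HPP {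
  hpp_n : nat;
  hpp_arc : rel 'I_hpp_n;
  hpp_s : 'I_hpp_n;
  hpp_t : 'I_hpp_n
}.

(* The flags marking the end vertices, then the adjacency matrix. *)
Definition enc_hpp (I : hpp_instance) : word :=
  enc_seq (fun i => [:: i == hpp_s I; i == hpp_t I]) (enum 'I_(hpp_n I)) ++
  flatten [seq [seq hpp_arc i j | j <- enum 'I_(hpp_n I)]
             | i <- enum 'I_(hpp_n I)].

Definition has_hamiltonian_path (I : hpp_instance) : Prop :=
  exists q : seq 'I_(hpp_n I),
    [/\ path (@hpp_arc I) (hpp_s I) q,
        last (hpp_s I) q = hpp_t I,
        uniq (hpp_s I :: q)
      & forall v, v \in hpp_s I :: q].

Definition HPP_language : language :=
  fun w => exists I : hpp_instance, w = enc_hpp I /\ has_hamiltonian_path I.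

(* The vertex set is ['I_nvert].  Rewards are meaningful on [profitable] only,
   traverse times on arcs only.  As the vehicles are identical, the set of
   vehicles is given by its cardinality [nveh]. *)
Record stop_instance := STOP {
  nvert : nat;
  arc : rel 'I_nvert;
  origin : 'I_nvert;
  dest : 'I_nvert;
  mandatory : {set 'I_nvert};
  profitable : {set 'I_nvert};
  reward : 'I_nvert -> nat;
  dtime : 'I_nvert -> 'I_nvert -> rat;
  nveh : nat;
  tlimit : rat;
  origin_neq_dest : origin != dest;
  mandatory_sub : mandatory \subset ~: [set origin; dest];
  profitable_sub : profitable \subset ~: [set origin; dest];
  vertices_cover : mandatory :|: profitable :|: [set origin; dest] = setT;
  mandatory_profitable_disjoint : mandatory :&: profitable = set0;
  reward_gt0 : forall i, i \in profitable -> 0 < reward i;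
  dtime_gt0 : forall i j, arc i j -> (0 < dtime i j)%R
}.

Definition enc_vertex (I : stop_instance) (i : 'I_(nvert I)) : word :=
  [:: i == origin I; i == dest I; i \in mandatory I; i \in profitable I] ++
  (if i \in profitable I then enc_nat (reward i) else [::]).

Definition enc_arc (I : stop_instance) (i j : 'I_(nvert I)) : word :=
  if arc i j then true :: enc_rat (dtime i j) else [:: false].

(* [nveh] stands for a listed set of vehicles, hence is written in unary; this
   also keeps solutions polynomially long in the size of the instance. *)
Definition enc_stop (I : stop_instance) : word :=
  enc_seq (@enc_vertex I) (enum 'I_(nvert I)) ++
  flatten [seq flatten [seq enc_arc i j | j <- enum 'I_(nvert I)]
             | i <- enum 'I_(nvert I)] ++
  enc_unary (nveh I) ++ enc_rat (tlimit I).

(* A route is the list of all its vertices, end vertices included. *)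
Definition traverse_time (I : stop_instance) (r : seq 'I_(nvert I)) : rat :=
  (\sum_(a <- zip r (behead r)) dtime a.1 a.2)%R.

Definition is_route (I : stop_instance) (r : seq 'I_(nvert I)) : Prop :=
  exists q : seq 'I_(nvert I),
    [/\ r = origin I :: q,
        path (@arc I) (origin I) q,
        last (origin I) q = dest I,
        uniq r
      & (traverse_time r <= tlimit I)%R].

Definition routes_through (I : stop_instance) (v : 'I_(nvert I))
    (rs : seq (seq 'I_(nvert I))) : nat :=
  count (fun r : seq 'I_(nvert I) => v \in r) rs.

Definition feasible (I : stop_instance) (rs : seq (seq 'I_(nvert I))) : Prop :=
  [/\ size rs <= nveh I,
      forall r, r \in rs -> is_route r,
      forall v, v \in mandatory I -> routes_through v rs = 1
    & forall v, v \in profitable I -> routes_through v rs <= 1].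

Definition enc_solution (I : stop_instance)
    (rs : seq (seq 'I_(nvert I))) : word :=
  enc_seq (enc_seq (fun i : 'I_(nvert I) => enc_nat i)) rs.

Definition D_FSTOP : language :=
  fun w => exists I : stop_instance,
    w = enc_stop I /\ exists rs : seq (seq 'I_(nvert I)), feasible rs.

Definition FSTOP : search_problem :=
  fun w y => exists (I : stop_instance) (rs : seq (seq 'I_(nvert I))),
    [/\ w = enc_stop I, y = enc_solution rs & feasible rs].

(* Main.v *)
Require Import Defs.
From HB Require Import structures.
From mathcomp Require Import all_boot all_order all_algebra.
From mathcomp Require Import zify.
From mathcomp Require Import boolp.

(* A digraph with end vertices s <> t becomes an STOP instance on the same
   digraph: one vehicle, every vertex other than s and t mandatory, none
   profitable, all traverse times 2 and a time limit T too large to matter.  As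
   soon as there is a mandatory vertex, a feasible solution is a single route
   through all vertices, that is, a Hamiltonian path.  Without one (at most two
   vertices) the empty set of routes is feasible, so these finitely many words
   are answered from a table.

   The translation is computed by a finite transducer reading the word from
   left to right; T = 2^m - 1, with m the length of the input, costs one extra
   counter tape, since its binary digits are m ones.  Such a transducer can be
   run after any machine, followed or not by an oracle query, which gives both
   kinds of reduction.  Ill-formed words need no explicit check: traverse time 2
   and the shape of the code of T are chosen so that their images are not the
   code of any instance. *)

Set Implicit Arguments.
Unset Strict Implicit.
Unset Printing Implicit Defensive.

Import Order.TTheory GRing.Theory Num.Theory.
Local Open Scope nat_scope.

(** * Running a transducer after a machine *)

(** [Read] marks one counter cell per letter, [Sweep] consumes the marks to write the time limit,
    [Turn] and [Rewind] bring the query head back to the start, [Reply] copies the first symbol of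
    the answer. *)
Inductive phase (Q : Type) :=
  Read of Q | Sweep | Turn | Rewind | Ask | Reply | Done.
Arguments Sweep {Q}. Arguments Turn {Q}. Arguments Rewind {Q}.
Arguments Ask {Q}. Arguments Reply {Q}. Arguments Done {Q}.

Definition phase_code Q (ph : phase Q) : Q + 'I_6 :=
  match ph with
  | Read q => inl q
  | Sweep => inr (@Ordinal 6 0 isT)
  | Turn => inr (@Ordinal 6 1 isT)
  | Rewind => inr (@Ordinal 6 2 isT)
  | Ask => inr (@Ordinal 6 3 isT)
  | Reply => inr (@Ordinal 6 4 isT)
  | Done => inr (@Ordinal 6 5 isT)
  end.

Definition phase_decode Q (x : Q + 'I_6) : phase Q :=
  match x with
  | inl q => Read q
  | inr i => nth Done [:: Sweep; Turn; Rewind; Ask; Reply] i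
  end.

Lemma phase_codeK Q : cancel (@phase_code Q) (@phase_decode Q).
Proof. by case. Qed.

HB.instance Definition _ (Q : finType) :=
  Finite.copy (phase Q) (can_type (@phase_codeK Q)).

Definition fresh (t : tape) : bool := all (pred1 None) (tright t).

Definition left_word (t : tape) : word := until_blank (scanned t :: tleft t).

(** A step rewrites every tape, so one that is left alone may still gain an explicit blank and need
    not stay equal as a list. *)
Definition idle (t : tape) : tape := write_move (scanned t, Stay) t.

Lemma tleft_idle t : tleft (idle t) = tleft t.
Proof. by []. Qed.

Lemma fresh_idle t : fresh (idle t) = fresh t.
Proof. by case: t => l [|a r]. Qed.

Lemma word_on_idle t : word_on (idle t) = word_on t.
Proof. by case: t => l [|a r]. Qed.

Lemma fresh_write a t : fresh t -> fresh (write_move (a, MoveRight) t).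
Proof. by case: t => l [|b r] //= /andP[]. Qed.

Lemma left_word_left a t :
  left_word (write_move (a, MoveLeft) t) = until_blank (tleft t).
Proof. by case: t => -[|b l] r. Qed.

Lemma left_word_cons t b w : left_word t = b :: w ->
  scanned t = Some b /\ until_blank (tleft t) = w.
Proof. by rewrite /left_word; case: (scanned t) => //= ? [-> ->]. Qed.

Lemma left_word_nil t : left_word t = [::] -> scanned t = None.
Proof. by rewrite /left_word; case: (scanned t). Qed.

Lemma until_blank_map_Some w : until_blank (map Some w) = w.
Proof. by elim: w => //= b w ->. Qed.

Lemma size_until_blank r : size (until_blank r) <= size r.
Proof. by elim: r => [|[b|] r IH]. Qed.

Lemma iter_step_halting (M : machine) O (c : config M) n :
  halting (cstate c) -> iter n (step O) c = c.
Proof.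
move=> hc; have e : step O c = c by case: c hc => q ts /= ->.
by elim: n => //= n ->.
Qed.

(** Upper bounds compose more easily than exact step counts, and they suffice because halting
    configurations are fixed by [step]. *)
Definition within (M : machine) (O : word -> word) (c : config M) (n : nat)
    (P : config M -> Prop) : Prop :=
  exists2 k, k <= n & P (iter k (step O) c).

Section Within.
Variables (M : machine) (O : word -> word).
Implicit Types (c : config M) (P : config M -> Prop).

Lemma within0 c n P : P c -> within O c n P.
Proof. by move=> Pc; exists 0. Qed.

Lemma within_trans c m n P P' :
  within O c m P -> (forall c', P c' -> within O c' n P') ->
  within O c (m + n) P'.
Proof.
move=> [k le_k Pk] /(_ _ Pk)[k' le_k' Pk'].
by exists (k' + k); [rewrite addnC leq_add | rewrite iterD].
Qed.

Lemma within_step c n P : within O (step O c) n P -> within O c n.+1 P.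
Proof. by move=> [k le_k Pk]; exists k.+1; rewrite ?iterSr. Qed.

Lemma within_leq c m n P : m <= n -> within O c m P -> within O c n P.
Proof. by move=> le_mn [k le_k Pk]; exists k; rewrite ?(leq_trans le_k). Qed.

Lemma within_imp c n P P' :
  (forall c', P c' -> P' c') -> within O c n P -> within O c n P'.
Proof. by move=> PP' [k le_k Pk]; exists k; last exact: PP'. Qed.

End Within.

Lemma size_write_move am t :
  size (tright (write_move am t)) <= (size (tright t)).+2.
Proof. by case: am t => a [] [l [|b r]] /=; rewrite ?size_behead //; lia. Qed.

(** Bounds the word handed over to the transducer. Without queries a step adds at most two cells. *)
Lemma size_tright_iter (M : machine) O x i n : oracle_free M ->
  size (tright (ctapes (iter n (step O) (init M x)) i)) <= size x + 2 * n.
Proof.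
move=> freeM; elim: n => [|n /=].
  by rewrite /= ffunE; case: eqP => _ /=; rewrite ?size_map; lia.
case: (iter n _ _) => q ts /= le_n.
case: ifP => _ /=; first lia.
rewrite freeM; case: (delta _ _) => q' a /=; rewrite ffunE.
by have := size_write_move (a i) (ts i); lia.
Qed.

(* The end of the code of the rational 2^m - 1, after its sign bit. *)
Definition limit_tail (m : nat) : word :=
  nseq m.*2 true ++ [:: false; true; true; false].

Section Transducer.
Variables (Q : Type) (next : Q -> bool -> Q) (out : Q -> bool -> word).
Variable fin : Q -> word.

Fixpoint transduce (q : Q) (w : word) : word :=
  if w is b :: w' then out q b ++ transduce (next q b) w' else fin q.

Definition padded_transduce (q : Q) (w : word) : word :=
  transduce q w ++ limit_tail (size w).

End Transducer.

(** * The composed machine and its phases *)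

Section Stage.
Variables (M1 : machine) (Q : finType) (B : nat) (q0 : Q).
Variables (next : Q -> bool -> Q) (out : Q -> bool -> word) (fin : Q -> word).
Variable ask : bool.
Hypothesis free1 : oracle_free M1.
Hypothesis le4B : 4 <= B.
Hypothesis out_le : forall q b, size (out q b) <= B.
Hypothesis fin_le : forall q, size (fin q) <= B.

Notation T := (tapes M1 + bool * bool)%type.
Notation Input := (inl (out_tape M1) : T).
Notation Counter := (inr (false, false) : T).
Notation Query := (inr (false, true) : T).
Notation Answer := (inr (true, false) : T).
Notation Output := (inr (true, true) : T).

(* [pend s] is empty if [s] is longer than [B]. *)
Notation pend := (@insub_bseq B bool).

Lemma pendE s : size s <= B -> val (pend s) = s.
Proof. by move=> le_s; rewrite /insub_bseq val_insubd le_s. Qed.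

(** Pending output is emptied onto the query tape, one bit per step, before the phase goes on; its
    bounded length keeps the state set finite. *)
Definition stage_delta (s : phase Q * B.-bseq bool) (r : {ffun T -> symbol}) :
    (phase Q * B.-bseq bool) * (T -> symbol * move) :=
  let: (ph, p) := s in
  if val p is b :: p' then
    ((ph, pend p'),
     fun i => if i == Query then (Some b, MoveRight) else (r i, Stay))
  else match ph with
  | Read q =>
    if r Input is Some b then
      ((Read (next q b), pend (out q b)),
       fun i => if i == Input then (Some b, MoveRight)
                else if i == Counter then (Some true, MoveRight)
                else (r i, Stay))
    else
      ((Sweep, pend (fin q)),
       fun i => if i == Counter then (None, MoveLeft) else (r i, Stay))
  | Sweep =>
    if r Counter is Some _ then
      ((Sweep, pend [:: true; true]),
       fun i => if i == Counter then (None, MoveLeft) else (r i, Stay))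
    else
      ((Turn, pend [:: false; true; true; false]), fun i => (r i, Stay))
  | Turn =>
    ((Rewind, pend [::]),
     fun i => if i == Query then (None, MoveLeft) else (r i, Stay))
  | Rewind =>
    if r Query is Some b then
      ((Rewind, pend [::]),
       fun i => if i == Query then (Some b, MoveLeft) else (r i, Stay))
    else
      ((Ask, pend [::]),
       fun i => if i == Query then (None, MoveRight) else (r i, Stay))
  | Reply =>
    ((Done, pend [::]),
     fun i => if i == Output then (r Answer, Stay) else (r i, Stay))
  | _ => (s, fun i => (r i, Stay))
  end.

Notation S := (state M1 + phase Q * B.-bseq bool)%type.

Definition comp_delta (s : S) (r : {ffun T -> symbol}) :
    S * {ffun T -> symbol * move} :=
  match s with
  | inl q =>
    if halting q then (inr (Read q0, pend [::]), [ffun i => (r i, Stay)])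
    else
      let: (q', a) := delta q [ffun i => r (inl i)] in
      (inl q', [ffun i : T => if i is inl j then a j else (r i, Stay)])
  | inr s2 =>
    let: (s', a) := stage_delta s2 r in (inr s', [ffun i => a i])
  end.

Definition comp_halting (s : S) : bool :=
  match s with
  | inr (Ask, _) => ~~ ask
  | inr (Done, _) => ask
  | _ => false
  end.

Definition comp_query (s : S) : option S :=
  if s is inr (Ask, _) then
    if ask then Some (inr (Reply, pend [::])) else None
  else None.

(** One construction for both reductions: without [ask] it halts with the translated word as output,
    with [ask] it submits that word to the oracle. *)
Definition comp_machine : machine :=
  @Machine S T (inl (in_tape M1)) (if ask then Output else Query)
    Query Answer isT (inl (start M1)) comp_halting comp_query comp_delta.

Variable O : word -> word.
Notation config := (config comp_machine).

Definition simulates (c1 : Defs.config M1) (c : config) : Prop :=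
  [/\ cstate c = inl (cstate c1),
      forall i, ctapes c (inl i) = ctapes c1 i
    & forall i, tleft (ctapes c (inr i)) = [::] /\ fresh (ctapes c (inr i))].

Lemma simulates_step c1 c : simulates c1 c -> ~~ halting (cstate c1) ->
  simulates (step id c1) (step O c).
Proof.
case: c1 c => q ts [s tc] [/= -> tsE auxE] nh.
rewrite /= free1 (negPf nh).
rewrite (_ : [ffun i => _] = [ffun i => scanned (ts i)]); last first.
  by apply/ffunP => i; rewrite !ffunE tsE.
case: (delta _ _) => q' a; split=> //= i; rewrite !ffunE ?tsE //.
by rewrite tleft_idle fresh_idle.
Qed.

Lemma simulates_iter x n :
  within O (init comp_machine x) n (simulates (iter n (step id) (init M1 x))).
Proof.
elim: n => [|n [k le_k sim_k]].
  exists 0 => //=; split=> //= i; rewrite !ffunE //=.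
(* Once [M1] has halted, a further step of the composed machine would leave the simulation, so [k]
   stays put. *)
case nh: (halting (cstate (iter n (step id) (init M1 x)))).
  exists k; first exact: leqW.
  by rewrite iterS -[step id _]/(iter 1 _ _) (iter_step_halting _ _ nh).
exists k.+1 => //; rewrite !iterS; apply: simulates_step => //.
by rewrite nh.
Qed.

(* [p] is the pending output, [w] the unread input; [C] and [R] describe the
   counter and the query tape. *)
Definition stage_at (ph : phase Q) (p w : word) (C R : tape -> Prop)
    (c : config) : Prop :=
  [/\ cstate c = inr (ph, pend p) /\ size p <= B,
      word_on (ctapes c Input) = w,
      C (ctapes c Counter),
      R (ctapes c Query)
    & fresh (ctapes c Output)].

Definition idle_stable (C : tape -> Prop) := forall t, C t -> C (idle t).

Definition written (o : word) (t : tape) : Prop :=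
  tleft t = rev (map Some o) /\ fresh t.

Definition swept (k : nat) (t : tape) : Prop := left_word t = nseq k true.

(** Loop invariant: the bits at and left of the head, nearest first, and those right of it recompose
    the full output [o]. *)
Definition rewinding (l o : word) (t : tape) : Prop :=
  left_word t = l /\ catrev l (until_blank (behead (tright t))) = o.

Lemma written_stable o : idle_stable (written o).
Proof. by move=> t [? ?]; split; rewrite ?fresh_idle. Qed.

Lemma written_write o b t :
  written o t -> written (rcons o b) (write_move (Some b, MoveRight) t).
Proof.
by move=> [l f]; split; [rewrite /= l map_rcons rev_rcons | apply: fresh_write].
Qed.

Definition busy (ph : phase Q) : bool :=
  if ph is (Ask | Done) then false else true.

Lemma step_busy ph p ts : busy ph ->
  step O (@Config comp_machine (inr (ph, p)) ts) =
  let: (s', a) := stage_delta (ph, p) [ffun i => scanned (ts i)] in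
  @Config comp_machine (inr s') [ffun i => write_move (a i) (ts i)].
Proof.
move=> bs.
have h : @halting comp_machine (inr (ph, p)) = false by case: (ph) bs.
have qN : @query comp_machine (inr (ph, p)) = None by case: (ph) bs.
rewrite /step h qN -[delta _ _]/(comp_delta _ _) /comp_delta.
case: (stage_delta _ _) => s' a.
by congr (@Config comp_machine _ _); apply/ffunP => i; rewrite !ffunE.
Qed.

Lemma emit ph p w C o c : busy ph -> idle_stable C ->
  stage_at ph p w C (written o) c ->
  within O c (size p) (stage_at ph [::] w C (written (o ++ p))).
Proof.
move=> bs stC; elim: p o c => [|b p IH] o c.
  by rewrite cats0; exact: within0.
case: c => s ts [/= [-> leB] inE cE qE fE].
apply: within_step; rewrite -cat_rcons; apply: IH.
rewrite step_busy // /stage_delta pendE //.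
split=> /=; rewrite ?ffunE //=.
- by split=> //; exact: ltnW.
- by rewrite word_on_idle.
- exact: stC.
- exact: written_write.
- by rewrite fresh_idle.
Qed.

(** Each letter costs one step to read and at most [B] to emit; the end of the input costs the same,
    hence [(size w).+1]. *)
Lemma read_phase q w k o c :
  stage_at (Read q) [::] w (written (nseq k true)) (written o) c ->
  within O c (B.+1 * (size w).+1)
    (stage_at Sweep [::] [::] (swept (k + size w))
              (written (o ++ transduce next out fin q w))).
Proof.
elim: w q k o c => [|b w IH] q k o c [].
  case: c => s ts [/= -> leB] inE cE qE fE.
  rewrite muln1; apply: within_step; apply: (within_leq (fin_le q)).
  apply: emit => //.
  rewrite step_busy // /stage_delta pendE //= ffunE.
  have -> : scanned (ts Input) = None.
    by move: inE; rewrite /word_on /scanned; case: (tright _) => [|[?|] ?].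
  split=> /=; rewrite ?ffunE //=.
  - by rewrite word_on_idle.
  - rewrite /swept left_word_left addn0; case: cE => -> _.
    by rewrite -map_rev until_blank_map_Some rev_nseq.
  - exact: written_stable.
  - by rewrite fresh_idle.
case: c => s ts [/= -> leB] inE cE qE fE.
rewrite mulnS addSn; apply: within_step.
apply: (within_trans (P := stage_at (Read (next q b)) [::] w
    (written (nseq k.+1 true)) (written (o ++ out q b)))).
  apply: (within_leq (out_le q b)); apply: emit => //.
    exact: written_stable.
  rewrite step_busy // /stage_delta pendE //= ffunE.
  have -> : scanned (ts Input) = Some b.
    move: inE; rewrite /word_on /scanned.
    by case: (tright _) => [|[?|] ?] //= [->].
  split=> /=; rewrite ?ffunE //=.
  - by rewrite eqxx; case: (ts _) inE => l [|[?|] r] //= [_ <-].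
  - rewrite (_ : true :: _ = rcons (nseq k true) true).
      exact: written_write.
    by rewrite -cats1 -(nseqD k 1) addn1.
  - exact: written_stable.
  - by rewrite fresh_idle.
move=> c'; rewrite catA -addSnnS; exact: IH.
Qed.

Lemma swept_stable k : idle_stable (swept k).
Proof. by []. Qed.

(** A mark costs one move and two emitted bits; the last 5 steps see the blank and emit the four
    closing bits. *)
Lemma sweep_phase k o c :
  stage_at Sweep [::] [::] (swept k) (written o) c ->
  within O c (3 * k + 5)
    (stage_at Turn [::] [::] (swept 0)
       (written (o ++ limit_tail k))).
Proof.
elim: k o c => [|k IH] o [s ts] [/= [-> leB] inE cE qE fE].
  apply: within_step; apply: (emit (p := [:: false; true; true; false])) => //.
  rewrite step_busy // /stage_delta pendE //= ffunE.
  rewrite (left_word_nil cE).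
  split=> /=; rewrite ?ffunE //=.
  - by rewrite word_on_idle.
  - exact: written_stable.
  - by rewrite fresh_idle.
have -> : 3 * k.+1 + 5 = (2 + (3 * k + 5)).+1 by lia.
apply: within_step.
apply: (within_trans (P := stage_at Sweep [::] [::] (swept k)
    (written (o ++ [:: true; true])))).
  apply: (emit (p := [:: true; true])) => //.
  rewrite step_busy // /stage_delta pendE //= ffunE.
  case: (left_word_cons cE) => -> {}cE.
  split=> /=; rewrite ?ffunE //=.
  - by split=> //; lia.
  - by rewrite word_on_idle.
  - by rewrite /swept left_word_left.
  - exact: written_stable.
  - by rewrite fresh_idle.
by move=> c' /IH; rewrite -catA.
Qed.

Lemma rewind_phase l w C o c : idle_stable C ->
  stage_at Rewind [::] w C (rewinding l o) c ->
  within O c (size l).+1 (stage_at Ask [::] w C (fun t => word_on t = o)).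
Proof.
move=> stC; elim: l c => [|b l IH] [s ts] [/= [-> leB] inE cE [lE qE] fE].
  apply: within_step; apply: within0.
  rewrite step_busy // /stage_delta pendE //= ffunE.
  rewrite (left_word_nil lE).
  split=> /=; rewrite ?ffunE //=.
  - by rewrite word_on_idle.
  - exact: stC.
  - by rewrite fresh_idle.
apply: within_step; apply: IH.
rewrite step_busy // /stage_delta pendE //= ffunE.
case: (left_word_cons lE) => -> {}lE.
split=> /=; rewrite ?ffunE //=.
- by rewrite word_on_idle.
- exact: stC.
- by split; rewrite ?left_word_left.
- by rewrite fresh_idle.
Qed.

Definition stage_time (n : nat) : nat :=
  B.+1 * n.+1 + (3 * n + 5) + (1 + (B * n.+1 + 2 * n + 5)).

Lemma size_transduce q w : size (transduce next out fin q w) <= B * (size w).+1.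
Proof.
elim: w q => [|b w IH] q /=; first by rewrite muln1.
by rewrite size_cat mulnS leq_add.
Qed.

Lemma stage_ask w c :
  stage_at (Read q0) [::] w (written [::]) (written [::]) c ->
  within O c (stage_time (size w))
    (stage_at Ask [::] [::] (swept 0)
       (fun t => word_on t = padded_transduce next out fin q0 w)).
Proof.
move=> c_at; apply: within_trans.
  apply: within_trans; first exact: (read_phase (k := 0) c_at).
  by move=> c'; exact: sweep_phase.
move=> [s ts] [/= [-> leB] inE cE [lE qE] fE].
rewrite add1n; apply: within_step.
apply: (within_leq (m := (size (padded_transduce next out fin q0 w)).+1)).
  rewrite !size_cat size_nseq /=.
  by have := size_transduce q0 w; lia.
rewrite -size_rev; apply: rewind_phase; first exact: swept_stable.
rewrite step_busy // /stage_delta pendE //=.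
split=> /=; rewrite ?ffunE //=.
- by rewrite word_on_idle.
- split; last by rewrite catrevE revK cats0.
  by rewrite left_word_left lE -map_rev until_blank_map_Some.
- by rewrite fresh_idle.
Qed.

Lemma comp_ask f c k x :
  (forall x, computes_within M1 id x (f x) (poly_bound c k x)) ->
  within O (init comp_machine x)
    (poly_bound c k x + (1 + stage_time (size x + 2 * poly_bound c k x)))
    (stage_at Ask [::] [::] (swept 0)
       (fun t => word_on t = padded_transduce next out fin q0 (f x))).
Proof.
move=> /(_ x)[hM fxE]; apply: within_trans; first exact: simulates_iter.
move=> [s tc]; set c1 := iter _ _ _ in hM fxE *; move=> [/= -> tE auxE].
rewrite add1n; apply: within_step.
have le_fx : size (f x) <= size x + 2 * poly_bound c k x.
  rewrite -fxE; apply: leq_trans (size_until_blank _) _.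
  exact: size_tright_iter.
apply: (within_leq (m := stage_time (size (f x)))).
  by rewrite /stage_time; nia.
apply: stage_ask; rewrite /= hM.
have auxW i : written [::] (tc (inr i)) by case: (auxE i).
split=> //=; rewrite ?ffunE.
- by rewrite word_on_idle tE fxE.
- exact: written_stable.
- exact: written_stable.
- by rewrite fresh_idle; case: (auxE (true, true)).
Qed.

End Stage.

(** * Polynomial time bounds and the two kinds of reduction *)

Lemma within_computes (M : machine) O x y m n : m <= n ->
  within O (init M x) m
    (fun c => halting (cstate c) /\ word_on (ctapes c (out_tape M)) = y) ->
  computes_within M O x y n.
Proof.
move=> le_mn [k le_k [h yE]]; rewrite /computes_within.
have -> : n = (n - k) + k by rewrite subnK // (leq_trans le_k).
by rewrite iterD iter_step_halting.
Qed.

(** Raising the exponent by one lets the bound dominate [size x] even when [k] is 0. *)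
Lemma poly_bound_linear A c k x :
  A * (size x + poly_bound c k x) + A <= poly_bound (A * (2 * c + 1)) k.+1 x.
Proof.
rewrite /poly_bound.
have leX : size x ^ k <= size x ^ k.+1 + 1.
  case: (size x) => [|n]; last by rewrite expnS; nia.
  by case: (k) => [|j]; rewrite ?expnS ?mul0n.
have leY : size x <= size x ^ k.+1.
  by case: (size x) => [|n] //; rewrite expnS leq_pmulr // expn_gt0.
by move: (size x ^ k) (size x ^ k.+1) leX leY => X Y; nia.
Qed.

Section Reductions.
Variables (Q : finType) (B : nat) (q0 : Q).
Variables (next : Q -> bool -> Q) (out : Q -> bool -> word) (fin : Q -> word).
Hypothesis le4B : 4 <= B.
Hypothesis out_le : forall q b, size (out q b) <= B.
Hypothesis fin_le : forall q, size (fin q) <= B.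
Notation g := (padded_transduce next out fin q0).

(** The 2 pays for the query and for copying its answer. *)
Lemma comp_time_le n m :
  m + (1 + stage_time B (n + 2 * m)) + 2 <=
  (4 * B + 20) * (n + m) + (4 * B + 20).
Proof. by rewrite /stage_time; nia. Qed.

Lemma poly_time_padded_transduce f :
  poly_time f -> poly_time (fun x => g (f x)).
Proof.
move=> [M1 [free1 [c [k fP]]]].
exists (comp_machine M1 B q0 next out fin false); split.
  by case=> // -[[]].
exists ((4 * B + 20) * (2 * c + 1)), k.+1 => x.
apply: within_computes (poly_bound_linear _ _ _ _) _.
apply: within_leq (comp_time_le _ _) _.
apply: within_leq (leq_addr _ _) _.
apply: within_imp (comp_ask q0 next false free1 le4B out_le fin_le id x fP).
by move=> [s ts] [/= [-> _]].
Qed.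

Lemma turing_reducible_padded_transduce f (L : language) (R : search_problem) :
  poly_time f -> (forall x, L x <-> exists y, R (g (f x)) y) ->
  turing_reducible L R.
Proof.
move=> [M1 [free1 [c [k fP]]]] LR.
exists (comp_machine M1 B q0 next out fin true).
exists ((4 * B + 20) * (2 * c + 1)), k.+1 => O solO x.
exists (head false (O (g (f x)))); split; last first.
  rewrite LR; case: (solO (g (f x))) => [[y [-> Ry]]|[-> nR]] /=.
    by split=> // _; exists y.
  by split=> // -[y /nR].
apply: within_computes (poly_bound_linear _ _ _ _) _.
apply: within_leq (comp_time_le _ _) _.
apply: within_trans.
  exact: (comp_ask q0 next true free1 le4B out_le fin_le O x fP).
move=> [s ts] [/= [-> _] _ _ gE fE].
apply: within_step; rewrite [step _ _]/=.
apply: within_step; rewrite step_busy // /stage_delta pendE //=.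
apply: within0.
rewrite !ffunE /= gE; split=> //.
have neO : O (g (f x)) = head false (O (g (f x))) :: behead (O (g (f x))).
  by case: (solO (g (f x))) => [[y [-> _]]|[-> _]].
rewrite neO /word_on /=.
(* Beyond the copied bit the output tape is still blank, so the word on it is the solver's tag
   alone. *)
move: fE; rewrite /fresh.
by case: (tright _) => [|a [|[b|] r]] //=; rewrite andbF.
Qed.

End Reductions.

(** * Answering short words from a table *)

Section Buffering.
Variables (Q : Type) (K : nat) (q0 : Q).
Variables (next : Q -> bool -> Q) (out : Q -> bool -> word) (fin : Q -> word).
Variable table : word -> word.

Notation run := (transduce next out (fun=> [::])).

(** The first [K] letters are only stored; the next one replays them all, so a word of at most [K]
    letters ends inside the buffer and can be looked up. *)
Definition buf_next (x : K.-bseq bool + Q) (b : bool) : K.-bseq bool + Q :=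
  match x with
  | inr q => inr (next q b)
  | inl s => if size s < K then inl (insub_bseq K (rcons s b))
             else inr (foldl next q0 (rcons s b))
  end.

Definition buf_out (x : K.-bseq bool + Q) (b : bool) : word :=
  match x with
  | inr q => out q b
  | inl s => if size s < K then [::] else run q0 (rcons s b)
  end.

Definition buf_fin (x : K.-bseq bool + Q) : word :=
  match x with inr q => fin q | inl s => table s end.

Lemma transduce_cat q s w :
  transduce next out fin q (s ++ w) =
  run q s ++ transduce next out fin (foldl next q s) w.
Proof. by elim: s q => //= b s IH q; rewrite IH catA. Qed.

Lemma transduce_buf w :
  transduce buf_next buf_out buf_fin (inl (insub_bseq K [::])) w =
  if size w <= K then table w else transduce next out fin q0 w.
Proof.
have inrE q u : transduce buf_next buf_out buf_fin (inr q) u =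
                transduce next out fin q u.
  by elim: u q => //= b u IH q; rewrite IH.
have main s : size s <= K ->
    transduce buf_next buf_out buf_fin (inl (insub_bseq K s)) w =
    if size (s ++ w) <= K then table (s ++ w)
    else transduce next out fin q0 (s ++ w).
  elim: w s => [|b w IH] s les /=; first by rewrite pendE // cats0 les.
  rewrite pendE // -cat_rcons.
  case: ltnP => [lts|ges]; first by rewrite IH ?size_rcons.
  rewrite inrE -transduce_cat; case: leqP => //.
  by rewrite size_cat size_rcons; lia.
by rewrite main.
Qed.

Lemma size_buf_out D x b : (forall q b, size (out q b) <= D) ->
  size (buf_out x b) <= D * K.+1.
Proof.
move=> outD.
have runD q s : size (run q s) <= D * size s.
  by elim: s q => [|c s IH] q //=; rewrite size_cat mulnS leq_add.
case: x => [s|q] /=; last by rewrite (leq_trans (outD q b)) // leq_pmulr.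
case: ifP => // _; apply: leq_trans (runD _ _) _.
by rewrite size_rcons leq_mul // ltnS size_bseq.
Qed.

End Buffering.

(** * The reduction *)

(** [Marker] expects the continuation bit of the vertex list, [FlagS] and [FlagT] the two end flags,
    the first being remembered; [Arcs] reads the matrix. *)
Inductive scan := Marker | FlagS | FlagT of bool | Arcs.

Definition scan_code (q : scan) : option (option (option bool)) :=
  match q with
  | Marker => None
  | FlagS => Some None
  | Arcs => Some (Some None)
  | FlagT a => Some (Some (Some a))
  end.

Definition scan_decode (x : option (option (option bool))) : scan :=
  match x with
  | None => Marker
  | Some None => FlagS
  | Some (Some None) => Arcs
  | Some (Some (Some a)) => FlagT a
  end.

Lemma scan_codeK : cancel scan_code scan_decode.
Proof. by case. Qed.

HB.instance Definition _ := Finite.copy scan (can_type scan_codeK).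

Definition scan_next (q : scan) (b : bool) : scan :=
  match q with
  | Marker => if b then FlagS else Arcs
  | FlagS => FlagT b
  | FlagT _ => Marker
  | Arcs => Arcs
  end.

(* [true] is sent to [true :: enc_rat 2]. *)
Definition arc_code (b : bool) : word :=
  if b then
    [:: true; false; true; false; true; true; false; true; true; false]
  else [:: false].

(* Begins a vertex flagged both as origin and as destination, so that no code
   of an instance continues this way. *)
Definition reject : word := [:: true; true; true].

(** A vertex keeps its end flags, is mandatory when neither is set, and is never profitable. *)
Definition scan_out (q : scan) (b : bool) : word :=
  match q with
  | Marker => if b then [::] else [:: false]
  | FlagS => [::]
  | FlagT a => [:: true; a; b; ~~ (a || b); false]
  | Arcs => arc_code b
  end.

(* After the arcs: one vehicle, in unary, and the sign of the time limit. *)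
Definition scan_fin (q : scan) : word :=
  if q is Arcs then [:: true; false; false] else reject.

Notation scan_word := (transduce scan_next scan_out scan_fin).

(** * Unique decodability of the codes of numbers *)

Lemma bitsE n : bits n = if n == 0 then [::] else odd n :: bits n./2.
Proof.
have fuelE f1 f2 m : m <= f1 -> m <= f2 -> bits_rec f1 m = bits_rec f2 m.
  elim: f1 f2 m => [|f1 IH] [|f2] [|m] //= le1 le2.
  by congr (_ :: _); apply: IH; lia.
rewrite /bits; case: n => [|n] //=; congr (_ :: _); apply: fuelE; lia.
Qed.

Lemma enc_natE n :
  enc_nat n = if n == 0 then [:: false] else [:: true, odd n & enc_nat n./2].
Proof. by rewrite {1}/enc_nat bitsE; case: eqP. Qed.

(** The code is self-delimiting: it shows whether the number is 0 and, if not, its parity, followed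
    by the code of its half. *)
Lemma enc_nat_cat_inj m n u v :
  enc_nat m ++ u = enc_nat n ++ v -> m = n /\ u = v.
Proof.
elim/ltn_ind: m n => m IH n; rewrite (enc_natE m) (enc_natE n).
case: (m =P 0) => [->|m0]; case: (n =P 0) => [->|n0] //= -[] // eo.
case/IH => [|eh ->]; first lia.
by split=> //; rewrite -(odd_double_half m) -(odd_double_half n) eo eh.
Qed.

(** The most significant digit would be a zero. *)
Lemma enc_nat_half n u v : enc_nat n ++ u <> [:: true, false, false & v].
Proof.
rewrite enc_natE; case: (n =P 0) => //= n0 [on].
rewrite enc_natE; case: (n./2 =P 0) => //= h0 _.
by apply: n0; rewrite -(odd_double_half n) on h0.
Qed.

Lemma enc_nat_pow m : enc_nat (2 ^ m).-1 = nseq m.*2 true ++ [:: false].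
Proof.
elim: m => // m IH; rewrite enc_natE.
have -> : (2 ^ m.+1).-1 = true + (2 ^ m).-1.*2.
  by rewrite expnS; have := expn_gt0 2 m; lia.
by rewrite half_bit_double IH oddD odd_double.
Qed.

Lemma enc_rat_nat n :
  enc_rat (Posz n)%:~R%R = false :: enc_nat n ++ enc_nat 1.
Proof. by rewrite /enc_rat numq_int denq_int ltrz0. Qed.

Lemma enc_rat_cat q u :
  enc_rat q ++ u = (q < 0)%R :: enc_nat `|numq q| ++ enc_nat `|denq q| ++ u.
Proof. by rewrite /enc_rat cat_cons catA. Qed.

Lemma enc_rat_cat_inj p q u v : enc_rat p ++ u = enc_rat q ++ v -> u = v.
Proof.
by rewrite !enc_rat_cat => -[_ /enc_nat_cat_inj[_ /enc_nat_cat_inj[_ ->]]].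
Qed.

Lemma unary1_cat m : [:: true; false; false] ++ limit_tail m =
  enc_unary 1 ++ enc_rat (Posz (2 ^ m).-1)%:~R%R.
Proof. by rewrite enc_rat_nat enc_nat_pow /limit_tail -catA. Qed.

(** These bits would code a negative rational with numerator 0. *)
Lemma enc_rat_neg0 q u v : enc_rat q ++ u <> [:: true, false & v].
Proof.
rewrite enc_rat_cat => -[ltq0] /(@enc_nat_cat_inj _ 0)[/eqP].
by rewrite absz_eq0 numq_eq0 => /eqP q0; rewrite q0 ltxx in ltq0.
Qed.

Lemma enc_rat_zero q u v : enc_rat q ++ u = [:: false, false & v] -> q = 0%R.
Proof.
rewrite enc_rat_cat => -[_] /(@enc_nat_cat_inj _ 0)[/eqP].
by rewrite absz_eq0 numq_eq0 => /eqP.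
Qed.

(** Fractions are reduced, so numerator 0 forces denominator 1. *)
Lemma enc_rat_den q u v :
  enc_rat q ++ u = [:: false, false & v] -> v = [:: true, true, false & u].
Proof.
move=> e; move: (enc_rat_zero e) => q0; move: e; rewrite {}q0.
by rewrite (enc_rat_nat 0) => -[].
Qed.

(* No reading of an adjacency bit can be mistaken for the fleet size and the
   time limit: this rejects the words with too many adjacency bits. *)
Lemma arc_code_overflow b w m k q :
  scan_word Arcs (b :: w) ++ limit_tail m <> enc_unary k ++ enc_rat q.
Proof.
have unary0 u v : enc_unary k ++ u = false :: v -> u = v.
  by case: (k) => [[]|].
have unary1 u v : enc_unary k ++ u = [:: true, false & v] -> u = v.
  by case: (k) => [|[[]|]].
have neg0 v : enc_rat q <> [:: true, false & v].
  by rewrite -[enc_rat q]cats0; exact: enc_rat_neg0.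
have den v : enc_rat q = [:: false, false & v] -> v = [:: true; true; false].
  by rewrite -[enc_rat q]cats0; exact: enc_rat_den.
move/esym; case: b => /=; first by move/unary1/neg0.
move/unary0; case: w => [|[] w] /=; [exact: neg0 | exact: neg0 |].
case: w => [|[] w] /=.
- by case=> _; exact: enc_nat_half.
(* The sign [false] followed by the code of an arc spells exactly the code of 4, which leaves no
   room for the nonempty tail. *)
- rewrite -[enc_rat q]cats0 => e.
  have {e} : enc_rat q ++ [::] =
      enc_rat (4%:Z)%:~R%R ++ scan_word Arcs w ++ limit_tail m.
    by rewrite e enc_rat_nat.
  by move/enc_rat_cat_inj/(congr1 size); rewrite /limit_tail !size_cat !addnS.
- by move/den; case: w => [|[] w].
Qed.

(** * Soundness: parsing an image back *)

Section Parsing.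
Variable I : stop_instance.
Implicit Type s : seq 'I_(nvert I).

Lemma reject_not_vertices s u v :
  reject ++ u <>
  flatten [seq true :: enc_vertex i | i <- s] ++ false :: v.
Proof.
case: s => [|i s] //= [/esym/eqP io /esym/eqP id _].
by have := origin_neq_dest I; rewrite -io -id eqxx.
Qed.

(** A word cut inside the vertex list yields [reject], which fits no instance; the constant last bit
    of a block makes its vertex unprofitable. *)
Lemma scan_vertices s w u v :
  scan_word Marker w ++ u =
  flatten [seq true :: enc_vertex i | i <- s] ++ false :: v ->
  (forall i, i \in s -> i \notin profitable I) /\
  exists w', scan_word Arcs w' ++ u = v /\
  w = flatten [seq [:: true; i == origin I; i == dest I] | i <- s] ++
      false :: w'.
Proof.
elim: s w => [|i s IH] [|[] w]; try by move/reject_not_vertices.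
- by case: w => [|a [|b w]].
- by case=> <-; split=> //; exists w.
2: by [].
case: w => [|a [|b w]]; try by move/reject_not_vertices.
rewrite /enc_vertex -!catA /= => -[-> -> _ iP]; rewrite -iP /=.
move/IH => [sP [w' [wE ->]]]; split; last by exists w'. 
by move=> j; rewrite inE => /orP[/eqP->|/sP //]; rewrite -iP.
Qed.

(** With too few adjacency bits the closing bits would be read as an arc of traverse time 0, against
    [dtime_gt0]; too many are excluded by [arc_code_overflow]. *)
Lemma scan_arcs (ps : seq ('I_(nvert I) * 'I_(nvert I))) w m k q :
  scan_word Arcs w ++ limit_tail m =
  flatten [seq enc_arc p.1 p.2 | p <- ps] ++ enc_unary k ++ enc_rat q ->
  w = [seq Defs.arc p.1 p.2 | p <- ps] /\ k = 1.
Proof.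
elim: ps w => [|p ps IH] [|b w].
- by case: k => [|[|k]].
- by move/arc_code_overflow.
- rewrite [flatten _]/= /enc_arc -catA; case: ifP => // pA e.
  have := dtime_gt0 pA.
  by rewrite (enc_rat_zero (esym (congr1 behead e))) ltxx.
rewrite [flatten _]/= /enc_arc -catA; case: b; case: ifP => pA // e; last first.
  by have [-> ->] := IH _ (congr1 behead e); rewrite /= pA.
have {}e : enc_rat (Posz 2)%:~R%R ++ (scan_word Arcs w ++ limit_tail m) =
     enc_rat (dtime p.1 p.2) ++ (flatten [seq enc_arc i.1 i.2 | i <- ps] ++
       enc_unary k ++ enc_rat q).
  by rewrite enc_rat_nat; exact: (congr1 behead e).
by have [-> ->] := IH _ (enc_rat_cat_inj e); rewrite /= pA.
Qed.

End Parsing.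

Lemma flatten_allpairs (S T : Type) (e : S -> T -> word) s t :
  flatten [seq flatten [seq e i j | j <- t] | i <- s] =
  flatten [seq e p.1 p.2 | p <- [seq (i, j) | i <- s, j <- t]].
Proof. by rewrite map_allpairs; elim: s => //= i s ->; rewrite flatten_cat. Qed.

Lemma enc_stop_cat (I : stop_instance) (s := enum 'I_(nvert I)) :
  enc_stop I =
  flatten [seq true :: enc_vertex i | i <- s] ++ false ::
  flatten [seq enc_arc p.1 p.2 | p <- [seq (i, j) | i <- s, j <- s]] ++
  enc_unary (nveh I) ++ enc_rat (tlimit I).
Proof. by rewrite /enc_stop flatten_allpairs -catA. Qed.

Lemma enc_hpp_cat (J : hpp_instance) (s := enum 'I_(hpp_n J)) :
  enc_hpp J =
  flatten [seq [:: true; i == hpp_s J; i == hpp_t J] | i <- s] ++ false ::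
  [seq hpp_arc p.1 p.2 | p <- [seq (i, j) | i <- s, j <- s]].
Proof. by rewrite /enc_hpp map_allpairs -catA. Qed.

(** The threshold 11 used below is the length for two vertices. *)
Lemma size_enc_hpp J : size (enc_hpp J) = hpp_n J * (3 + hpp_n J) + 1.
Proof.
rewrite enc_hpp_cat size_cat /= size_map size_allpairs size_enum_ord.
have -> (s : seq 'I_(hpp_n J)) :
    size (flatten [seq [:: true; i == hpp_s J; i == hpp_t J] | i <- s]) =
    size s * 3.
  by elim: s => //= i s ->; rewrite mulSn.
by rewrite size_enum_ord; lia.
Qed.

Lemma reject_not_stop u : ~ D_FSTOP (reject ++ u).
Proof. by move=> [I []]; rewrite enc_stop_cat => /reject_not_vertices. Qed.

(* With at least three vertices some vertex is mandatory, so the empty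
   collection of routes is infeasible. *)
Lemma scan_sound w : 11 < size w ->
  D_FSTOP (scan_word Marker w ++ limit_tail (size w)) -> HPP_language w.
Proof.
move=> gt11 [I []]; rewrite enc_stop_cat.
move/scan_vertices => [profN [w' [/scan_arcs[w'E nveh1] wE]]]
  [rs [le_rs rtP mandP _]].
pose J := HPP (@Defs.arc I) (origin I) (dest I).
have eJ : w = enc_hpp J by rewrite enc_hpp_cat wE w'E.
exists J; split=> //.
have coverP v : [|| v \in mandatory I, v == origin I | v == dest I].
  have := in_setT v; rewrite -(vertices_cover I) !inE.
  by rewrite (negPf (profN v _)) ?mem_enum // orbF.
case: rs le_rs rtP mandP => [|r [|r' rs]]; rewrite nveh1 //= => _.
  move=> _ mand0; suff : nvert I <= 2.
    by move: gt11; rewrite eJ size_enc_hpp /=; nia.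
  rewrite -[nvert I]card_ord -cardsT.
  have sub : [set: 'I_(nvert I)] \subset [set origin I; dest I].
    apply/subsetP => v _; rewrite !inE.
    by have := coverP v; case: (boolP (v \in _)) => // /mand0.
  by rewrite (leq_trans (subset_leq_card sub)) // cards2; case: (_ != _).
move=> /(_ r (mem_head _ _))[q [rE pq lq uq _]] mand1.
exists q; rewrite -rE; split=> // v.
case/or3P: (coverP v) => [/mand1|/eqP->|/eqP->].
- by rewrite /routes_through /= addn0; case: (v \in r).
- by rewrite rE mem_head.
- by rewrite rE -lq mem_last.
Qed.

(** * Completeness: the instance built from a digraph *)

Section Complete.
Variable J : hpp_instance.
Notation n := (hpp_n J).
Notation s := (hpp_s J).
Notation t := (hpp_t J).
Hypothesis neq_st : s != t.
Variable T : nat.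

Let profitable0 : (set0 : {set 'I_n}) \subset ~: [set s; t].
Proof. exact: sub0set. Qed.

Let cover : ~: [set s; t] :|: set0 :|: [set s; t] = setT.
Proof. by rewrite setU0 setUC setUCr. Qed.

Let disjoint : ~: [set s; t] :&: set0 = set0.
Proof. exact: setI0. Qed.

Let reward_pos i : i \in (set0 : {set 'I_n}) -> 0 < 0.
Proof. by rewrite inE. Qed.

Let time_pos i j : @hpp_arc J i j -> (0 < (Posz 2)%:~R :> rat)%R.
Proof. by []. Qed.

Definition stop_of_hpp : stop_instance :=
  @STOP n (@hpp_arc J) s t (~: [set s; t]) set0 (fun=> 0)
    (fun _ _ => (Posz 2)%:~R%R) 1 (Posz T)%:~R%R
    neq_st (subxx _) profitable0 cover disjoint reward_pos time_pos.

Lemma scan_hpp_vertices r u :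
  scan_word Marker (flatten [seq [:: true; i == s; i == t] | i <- r] ++
                    false :: u) =
  flatten [seq true :: @enc_vertex stop_of_hpp i | i <- r] ++
  false :: scan_word Arcs u.
Proof.
by elim: r => //= i r ->; rewrite /enc_vertex /= !inE.
Qed.

Lemma scan_hpp_arcs ps :
  scan_word Arcs [seq @hpp_arc J p.1 p.2 | p <- ps] =
  flatten [seq @enc_arc stop_of_hpp p.1 p.2 | p <- ps] ++
  [:: true; false; false].
Proof.
elim: ps => //= p ps ->; rewrite /enc_arc /= -catA; congr (_ ++ _).
Qed.

Lemma enc_stop_of_hpp m : T = (2 ^ m).-1 ->
  enc_stop stop_of_hpp = scan_word Marker (enc_hpp J) ++ limit_tail m.
Proof.
move=> TE; rewrite enc_stop_cat enc_hpp_cat scan_hpp_vertices scan_hpp_arcs.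
by rewrite -catA cat_cons -catA unary1_cat /= TE.
Qed.

Lemma stop_of_hpp_feasible : has_hamiltonian_path J -> 2 * n <= T ->
  exists rs, @feasible stop_of_hpp rs.
Proof.
move=> [q [pq lq uq all_q]] leT; exists [:: s :: q]; split=> //= [r|v _|v].
- rewrite inE => /eqP->; exists q; split=> //.
  rewrite /traverse_time /= big_const_seq count_predT iter_addr_0.
  rewrite -mulr_natr -!pmulrn -natrM ler_nat (leq_trans _ leT) // leq_mul2l /=.
  have := max_card (mem (s :: q)).
  rewrite (card_uniqP uq) card_ord size_zip /=.
  by move/ltnW; apply: leq_trans; exact: geq_minr.
- by rewrite /routes_through /= all_q.
- by rewrite inE.
Qed.
End Complete.

Lemma scan_complete w : 11 < size w -> HPP_language w ->
  D_FSTOP (scan_word Marker w ++ limit_tail (size w)).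
Proof.
move=> gt11 [J [wE hamJ]].
(* A Hamiltonian path with equal ends has a single vertex, and the word of such a digraph is too
   short. *)
have neq_st : hpp_s J != hpp_t J.
  apply/eqP => eq_st; case: hamJ => -[|v q] [_ lq uq all_q].
    move: gt11; suff n1 : hpp_n J <= 1 by rewrite wE size_enc_hpp; nia.
    rewrite -[hpp_n J]card_ord -[leqRHS](cards1 (hpp_s J)) -cardsT.
    apply/subset_leq_card/subsetP => v _; rewrite inE.
    by have := all_q v; rewrite inE.
  by move: uq; rewrite eq_st -{1}lq /= mem_last.
exists (stop_of_hpp neq_st (2 ^ size w).-1); split.
  by rewrite (enc_stop_of_hpp _ (erefl _)) -wE.
apply: stop_of_hpp_feasible => //.
(* A route has at most [hpp_n J] arcs of time 2, and [2 * hpp_n J <= size w <= 2 ^ size w - 1]. *)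
have : 2 * hpp_n J <= size w by rewrite wE size_enc_hpp; nia.
by have := ltn_expl (size w) (isT : 1 < 2); lia.
Qed.


(* Two vertices, no arc, one vehicle, and the sign of the time limit. *)
Definition yes_prefix : word :=
  [:: true; true; false; false; false; true; false; true; false; false; false;
      false; false; false; false; true; false; false].

(** * Short words and the final reduction *)

Lemma trivial_stop m : D_FSTOP (yes_prefix ++ limit_tail m).
Proof.
have disj : (set0 : {set 'I_2}) :&: set0 = set0 by exact: setI0.
have rew i : i \in (set0 : {set 'I_2}) -> 0 < 0 by rewrite inE.
have dt (i j : 'I_2) : (fun _ _ => false) i j -> (0 < 0 :> rat)%R by [].
have cov : set0 :|: set0 :|: [set ord0; ord_max] = [set: 'I_2].
  by apply/setP => -[[|[|]] //= lt2]; rewrite !inE.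
exists (@STOP 2 (fun _ _ => false) ord0 ord_max set0 set0 (fun=> 0)
  (fun _ _ => 0%R) 1 (Posz (2 ^ m).-1)%:~R%R isT (sub0set _) (sub0set _) cov disj rew dt).
split; last by exists [::]; split=> // v; rewrite inE.
have e2 : enum 'I_2 = [:: ord0; ord_max].
  by apply: (inj_map val_inj); rewrite val_enum_ord.
rewrite enc_stop_cat [enum _]e2 -[nveh _]/1.
rewrite -[tlimit _]/((Posz (2 ^ m).-1)%:~R%R).
by rewrite -unary1_cat /enc_vertex /= !inE.
Qed.

(** Consulted only on the finitely many words that fit in the buffer, it is hard-wired into the
    machine, so a classical test of membership is harmless. *)
Definition hpp_table (w : word) : word :=
  if `[< HPP_language w >] then yes_prefix else reject.

Notation reduction_next := (@buf_next scan 11 Marker scan_next).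
Notation reduction_out := (@buf_out scan 11 Marker scan_next scan_out).
Notation reduction_fin := (@buf_fin scan 11 scan_fin hpp_table).

Definition reduction : word -> word :=
  padded_transduce reduction_next reduction_out reduction_fin
    (inl (insub_bseq 11 [::])).

Lemma reductionP w : HPP_language w <-> D_FSTOP (reduction w).
Proof.
rewrite /reduction /padded_transduce transduce_buf .
case: leqP => [_|gt11].
  rewrite /hpp_table; case: asboolP => [hw|nhw].
    by split=> // _; exact: trivial_stop.
  by split=> // /reject_not_stop.
by split; [exact: scan_complete | exact: scan_sound].
Qed.

(** 10 is the length of the code of an arc, 12 the number of letters replayed when the buffer
    overflows. *)
Lemma size_reduction_out x b : size (reduction_out x b) <= 10 * 12.
Proof. by apply: size_buf_out => -[||a|] c //=; case: c. Qed.

Lemma size_reduction_fin x : size (reduction_fin x) <= 10 * 12.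
Proof. by case: x => [s|[||a|]] //=; rewrite /hpp_table; case: ifP. Qed.

Theorem corollary1 (HPP_hard : NP_hard HPP_language) :
  NP_hard D_FSTOP /\ NP_hard_search FSTOP.
Proof.
have red L : NP L ->
    exists2 f, poly_time f & forall x, L x <-> D_FSTOP (reduction (f x)).
  move=> /HPP_hard[f [fP Lf]]; exists f => // x.
  by rewrite Lf; exact: reductionP.
split=> L /red[f fP Lf].
  exists (fun x => reduction (f x)); split=> //.
  exact: poly_time_padded_transduce size_reduction_out size_reduction_fin _ fP.
apply: (turing_reducible_padded_transduce (q0 := inl (insub_bseq 11 [::]))
  (next := reduction_next) _ size_reduction_out size_reduction_fin fP) => // x.
(* An instance is feasible exactly when it has a coded solution, so the translation for [D_FSTOP]
   also serves the search problem. *)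
rewrite Lf -/(reduction _).
split=> [[I [wE [rs feas]]]|[y [I [rs [wE _ feas]]]]].
  by exists (enc_solution rs), I, rs; split.
by exists I; split=> //; exists rs.
Qed.
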